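(* Let $n\in\mathbb N$, and let $F,P\subset\mathrm{GL}_n(\mathbb R)$ be the sets defined in the context. Then: (i) $\lambda_{\mathrm{GL}_n}(\overline F\cdot p\cap\overline F\cdot q)=0$ for every distinct pair $p,q\in P$; (ii) $\lambda_{\mathrm{GL}_n}\bigl(\mathrm{GL}_n(\mathbb R)\setminus\bigcup\{\overline F\cdot p: p\in P\}\bigr)=0$.
   Context: $\lambda_{\mathrm{GL}_n}$ is the (left) Haar measure of $\mathrm{GL}_n(\mathbb R)$, $\overline F$ is the closure of $F$ in $\mathrm{GL}_n(\mathbb R)$, and $\mathrm O_n$ is the group of real orthogonal $n\times n$ matrices. For a set $S$ of matrices and a matrix $p$, $S\cdot p=\{sp:s\in S\}$. $F$ is the set of all matrices of the form $s\,k\,z$ where $s\in[1,2)$, $k\in\mathrm O_n$, and $z$ is the upper triangular matrix with entries $z_{i,i}=w_i$ for $1\le i\le n$, $z_{i,j}=w_iy_{i,j}$ for $i<j$, and $z_{i,j}=0$ for $i>j$, with $w_1,\dots,w_{n-1}\in[1,2)$, $w_n=\prod_{i=1}^{n-1}w_i^{-1}$, and $y_{i,j}\in[0,1)$ for $1\le i<j\le n$. $P$ is the set of all matrices of the form $2^{\lambda}q$ where $\lambda\in\mathbb Z$ and $q$ is the upper triangular matrix with entries $q_{i,i}=2^{\kappa_i}$ for $1\le i\le n$, $q_{i,j}=2^{\kappa_j}\mu_{i,j}$ for $i<j$, and $q_{i,j}=0$ for $i>j$, with $\kappa_1,\dots,\kappa_{n-1}\in\mathbb Z$, $\kappa_n=-\sum_{i=1}^{n-1}\kappa_i$,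 and $\mu_{i,j}\in\mathbb Z$ for $1\le i<j\le n$. *)

(* Defs.v *)
From HB Require Import structures.
From mathcomp Require Import all_boot all_order all_algebra.
From mathcomp Require Import all_classical all_reals all_analysis.
Import numFieldNormedType.Exports.

Set Implicit Arguments.
Unset Strict Implicit.
Unset Printing Implicit Defensive.

Import Order.TTheory GRing.Theory Num.Theory.
Local Open Scope classical_set_scope.
Local Open Scope ring_scope.

(* As a [set_type], it carries the topology induced by 'M[R]_n; in particular
   [closure] on [GL R n] is the closure in GL_n(R), not in the space of all
   matrices. *)
Definition GL (R : realType) (n : nat) : Type :=
  set_type [set A : 'M[R]_n | A \in unitmx].

HB.instance Definition _ (R : realType) (n : nat) := Topological.on (GL R n).

Section GLgroup.
Variables (R : realType) (n : nat).

Definition mx_of_GL (g : GL R n) : 'M[R]_n := val g.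

Lemma mx_of_GL_unit (g : GL R n) : mx_of_GL g \in unitmx.
Proof. by have := set_valP g. Qed.

Lemma mx_of_GL_inj : injective mx_of_GL.
Proof. exact: val_inj. Qed.

Definition toGL (A : 'M[R]_n) (uA : A \in unitmx) : GL R n :=
  exist _ A (mem_set uA).

Fact GL_one_subproof : (1%:M : 'M[R]_n) \in unitmx.
Proof. exact: unitmx1. Qed.

Fact GL_mul_subproof (g h : GL R n) : mx_of_GL g *m mx_of_GL h \in unitmx.
Proof. by rewrite unitmx_mul !mx_of_GL_unit. Qed.

Fact GL_inv_subproof (g : GL R n) : invmx (mx_of_GL g) \in unitmx.
Proof. by rewrite unitmx_inv mx_of_GL_unit. Qed.

Definition GL_one : GL R n := toGL GL_one_subproof.
Definition GL_mul (g h : GL R n) : GL R n := toGL (GL_mul_subproof g h).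
Definition GL_inv (g : GL R n) : GL R n := toGL (GL_inv_subproof g).

Fact GL_mulA : associative GL_mul.
Proof. by move=> f g h; apply: mx_of_GL_inj; exact: mulmxA. Qed.

Fact GL_mul1g : left_id GL_one GL_mul.
Proof. by move=> g; apply: mx_of_GL_inj; exact: mul1mx. Qed.

Fact GL_mulg1 : right_id GL_one GL_mul.
Proof. by move=> g; apply: mx_of_GL_inj; exact: mulmx1. Qed.

Fact GL_mulVg : left_inverse GL_one GL_inv GL_mul.
Proof. by move=> g; apply: mx_of_GL_inj; exact/mulVmx/mx_of_GL_unit. Qed.

Fact GL_mulgV : right_inverse GL_one GL_inv GL_mul.
Proof. by move=> g; apply: mx_of_GL_inj; exact/mulmxV/mx_of_GL_unit. Qed.

HB.instance Definition _ := isGroup.Build (GL R n)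
  GL_mulA GL_mul1g GL_mulg1 GL_mulVg GL_mulgV.
HB.instance Definition _ := isPointed.Build (GL R n) GL_one.

End GLgroup.

Notation borelType T := (g_sigma_algebraType (@open T)).

Definition radon_measure (R : realType) (T : ptopologicalType)
    (mu : {measure set (borelType T) -> \bar R}) : Prop :=
  [/\ forall K : set T, compact K -> (mu K < +oo)%E,
      forall A : set (borelType T), measurable A ->
        mu A = ereal_inf [set mu U | U in [set U : set T | open U /\ A `<=` U]]
    & forall U : set T, open U ->
        mu U = ereal_sup [set mu K | K in [set K : set T | compact K /\ K `<=` U]]].

(* "The" left Haar measure is only determined up to a positive factor: it is any
   nonzero left-invariant Radon measure. *)
Definition left_haar_measure (R : realType) (n : nat)
    (mu : {measure set (borelType (GL R n)) -> \bar R}) : Prop :=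
  [/\ radon_measure mu,
      mu setT != 0%E
    & forall (g : GL R n) (A : set (borelType (GL R n))), measurable A ->
        mu [set (g * x)%g | x in A] = mu A].

Section tiling.
Variables (R : realType) (n : nat).

Definition orthogonal_mx (k : 'M[R]_n) : Prop := k^T *m k = 1%:M.

Definition z_mx (w : 'I_n -> R) (y : 'I_n -> 'I_n -> R) : 'M[R]_n :=
  \matrix_(i, j) (if i == j then w i
                  else if (i < j)%N then w i * y i j else 0).

Definition q_mx (kappa : 'I_n -> int) (mu : 'I_n -> 'I_n -> int) : 'M[R]_n :=
  \matrix_(i, j) (if i == j then 2 ^ kappa i
                  else if (i < j)%N then 2 ^ kappa j * (mu i j)%:~R else 0).

(* Indices are 0-based: [i.+1 < n] singles out the indices 1, ..., n-1 of the
   text and [i.+1 = n] the index n. *)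
Definition F_mx : set 'M[R]_n :=
  [set A | exists (s : R) (k : 'M[R]_n) (w : 'I_n -> R) (y : 'I_n -> 'I_n -> R),
    [/\ s \in `[1, 2[, orthogonal_mx k,
        forall i : 'I_n, (i.+1 < n)%N -> w i \in `[1, 2[,
        forall i : 'I_n, i.+1 = n -> w i = \prod_(j < n | (j.+1 < n)%N) (w j)^-1
      & forall i j : 'I_n, (i < j)%N -> y i j \in `[0, 1[]
    /\ A = s *: (k *m z_mx w y)].

Definition P_mx : set 'M[R]_n :=
  [set A | exists (lambda : int) (kappa : 'I_n -> int) (mu : 'I_n -> 'I_n -> int),
    (forall i : 'I_n, i.+1 = n ->
       kappa i = - \sum_(j < n | (j.+1 < n)%N) kappa j)
    /\ A = (2 ^ lambda) *: q_mx kappa mu].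

Lemma upper_unitmx (A : 'M[R]_n) :
  (forall i j : 'I_n, (j < i)%N -> A i j = 0) -> (forall i, A i i != 0) ->
  A \in unitmx.
Proof.
move=> A0 Ad; rewrite unitmxE -det_tr det_trig; last first.
  by apply/is_trig_mxP => i j ij; rewrite mxE A0.
by rewrite unitfE; apply/prodf_neq0 => i _; rewrite mxE.
Qed.

Lemma F_mx_unit : F_mx `<=` [set A | A \in unitmx].
Proof.
move=> _ [s [k [w [y [[s12 kk w12 wn _] ->]]]]] /=.
have ge1_neq0 (x : R) : x \in `[1, 2[ -> x != 0.
  by rewrite in_itv /= => /andP[x1 _]; rewrite gt_eqF// (lt_le_trans _ x1).
rewrite unitmxZ ?unitfE ?ge1_neq0// unitmx_mul; apply/andP; split.
  by have [_] := mulmx1_unit kk.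
apply: upper_unitmx => [i j ji|i]; rewrite mxE ?eqxx.
  by rewrite -val_eqE gtn_eqF// ltnNge ltnW.
have [/w12/ge1_neq0//|] := ltnP i.+1 n.
move=> ni; rewrite wn; last by apply/eqP; rewrite eqn_leq ni ltn_ord.
by apply/prodf_neq0 => j /w12/ge1_neq0; rewrite invr_eq0.
Qed.

Lemma P_mx_unit : P_mx `<=` [set A | A \in unitmx].
Proof.
move=> _ [l [kappa [mu [_ ->]]]] /=.
have pow_neq0 (m : int) : (2 : R) ^ m != 0 by rewrite expfz_neq0.
rewrite unitmxZ ?unitfE//; apply: upper_unitmx => [i j ji|i]; rewrite mxE ?eqxx//.
by rewrite -val_eqE gtn_eqF// ltnNge ltnW.
Qed.

Definition F : set (GL R n) := [set g | F_mx (mx_of_GL g)].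
Definition P : set (GL R n) := [set g | P_mx (mx_of_GL g)].

Definition right_translate (S : set (GL R n)) (p : GL R n) : set (GL R n) :=
  [set (s * p)%g | s in S].

End tiling.

Arguments F R n : clear implicits.
Arguments P R n : clear implicits.

(* Main.v *)
Require Import Defs.
From mathcomp Require Import all_boot all_order all_algebra.
From mathcomp Require Import all_classical all_reals all_analysis.
From mathcomp Require Import measurable_realfun ring lra.
Import numFieldNormedType.Exports.
Set Implicit Arguments.
Unset Strict Implicit.
Unset Printing Implicit Defensive.
Import Order.TTheory GRing.Theory Num.Theory.
Local Open Scope classical_set_scope.
Local Open Scope ring_scope.

(** The translates [F * p], [p] in [P], partition GL_n(R) exactly; only their
    closures overlap, and they do so along hypersurfaces.

    The partition comes from the Iwasawa coordinates [s * k * z(w, y)] of an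
    invertible matrix ([iwasawa]), with [s] and the [w i] positive, the product
    of the [w i] equal to 1 and [y] arbitrary.  With [D] and [D'] the diagonal
    matrices of the [w i] and of the [2 ^ kappa i], the triangular factors of
    [F] and [P] multiply to [D (1 + y) (1 + mu) D'] ([mul_z_q_mx]), where [1 + y]
    and [1 + mu] are unipotent and [mu] is integral.  The interval `[1, 2[ is a
    fundamental domain for the powers of 2 acting on the positive reals, and the
    unipotent matrices with entries in `[0, 1[ form one for the integral
    unipotent matrices, so every invertible matrix is [f p] for exactly one [p]
    ([tiling_cover], [tiling_uniq]).  Existence leaves nothing outside the
    union, which is the second claim.

    By uniqueness, a point common to the closures of [F p] and [F q] lies in
    the right translate by [p] or by [q] of the boundary [closure F \ F].  The
    inequalities that define [F] in terms of [s], [w], [y] are polynomial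
    inequalities in the entries of [A], because the coordinates are quotients
    of minors of the Gram matrix [A^T A] and of the determinant.  So the boundary
    is contained in the union of finitely many zero sets of nonzero
    polynomials ([boundary_F]).

    It remains to see that a left Haar measure does not charge the zero set of a
    polynomial [f] that does not vanish identically on the group ([haar_zeros]).
    Near a point [z], choose [v] such that [f ((1 + v) z)] is nonzero.  For [y]
    close to [z] the polynomial [t |-> f ((1 + t v) y)] is then nonzero of
    degree less than some fixed [D], so that [y] belongs to at most [D] of the
    left translates of the zero set by the [(1 + t v)^-1].  These translates
    all have the same measure, and for small [t] their parts coming from a small
    neighbourhood of [z] stay in an open set of finite measure: infinitely many
    of them leave room only for measure zero ([null_of_overlap]). *)

(** * Polynomial functions on matrices *)

(** Generation by constants, entries, sums and products gives both properties
    that matter, continuity and polynomiality along lines, by induction. *)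
Inductive polyfun (R : realType) (n : nat) : ('M[R]_n -> R) -> Prop :=
| polyfun_cst c : polyfun (fun=> c)
| polyfun_coord i j : polyfun (fun A => A i j)
| polyfun_add f g : polyfun f -> polyfun g -> polyfun (fun A => f A + g A)
| polyfun_mul f g : polyfun f -> polyfun g -> polyfun (fun A => f A * g A).

Section polyfun_theory.
Variables (R : realType) (n : nat).
Implicit Types f g : 'M[R]_n -> R.

Lemma polyfun_continuous f : polyfun f -> continuous f.
Proof.
elim=> {f} [c|i j|f g _ cf _ cg|f g _ cf _ cg] A.
- exact: cst_continuous.
- exact: coord_continuous.
- exact: (continuousD (cf A) (cg A)).
- exact: (continuousM (cf A) (cg A)).
Qed.

(** The degree bound is uniform in the line: this bounds the number of zeros
    on all lines at once. *)
Lemma polyfun_line f : polyfun f ->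
  exists D, forall A B, exists2 p : {poly R},
    (size p <= D)%N & forall t, f (A + t *: B) = p.[t].
Proof.
elim=> {f} [c|i j|f g _ [Df hf] _ [Dg hg]|f g _ [Df hf] _ [Dg hg]].
- by exists 1%N => A B; exists c%:P => [|t]; rewrite ?size_polyC_leq1 ?hornerC.
- exists 2%N => A B; exists ((A i j)%:P + (B i j)%:P * 'X) => [|t].
    rewrite (leq_trans (size_polyD _ _))// geq_max (leq_trans (size_polyC_leq1 _))//=.
    by rewrite mul_polyC (leq_trans (size_scale_leq _ _))// size_polyX.
  by rewrite !hornerE !mxE mulrC.
- exists (maxn Df Dg) => A B; have [p sp fp] := hf A B; have [q sq gq] := hg A B.
  exists (p + q) => [|t]; last by rewrite fp gq hornerD.
  rewrite (leq_trans (size_polyD _ _))// geq_max !leq_max sp sq.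
  by rewrite orbT.
- exists (Df + Dg)%N => A B.
  have [p sp fp] := hf A B; have [q sq gq] := hg A B.
  exists (p * q) => [|t]; last by rewrite fp gq hornerM.
  rewrite (leq_trans (size_polyMleq _ _))// (leq_trans (leq_pred _))//.
  exact: leq_add.
Qed.

Lemma polyfun_ext f g : f =1 g -> polyfun f -> polyfun g.
Proof. by move=> /funext ->. Qed.

Lemma polyfun_sub f g : polyfun f -> polyfun g -> polyfun (fun A => f A - g A).
Proof.
move=> pf pg; apply: (@polyfun_ext (fun A => f A + (-1) * g A)).
  by move=> A; rewrite mulN1r.
by apply: polyfun_add => //; apply: polyfun_mul => //; exact: polyfun_cst.
Qed.

Lemma polyfun_sum (I : Type) (s : seq I) (F : I -> 'M[R]_n -> R) :
  (forall i, polyfun (F i)) -> polyfun (fun A => \sum_(i <- s) F i A).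
Proof.
move=> pF; elim: s => [|i s ih].
  by apply: polyfun_ext (polyfun_cst n 0) => A; rewrite big_nil.
by apply: polyfun_ext (polyfun_add (pF i) ih) => A; rewrite big_cons.
Qed.

Lemma polyfun_prod (I : Type) (s : seq I) (F : I -> 'M[R]_n -> R) :
  (forall i, polyfun (F i)) -> polyfun (fun A => \prod_(i <- s) F i A).
Proof.
move=> pF; elim: s => [|i s ih].
  by apply: polyfun_ext (polyfun_cst n 1) => A; rewrite big_nil.
by apply: polyfun_ext (polyfun_mul (pF i) ih) => A; rewrite big_cons.
Qed.

Lemma polyfun_exp f k : polyfun f -> polyfun (fun A => f A ^+ k).
Proof.
move=> pf; apply: (@polyfun_ext (fun A => \prod_(i < k) f A)).
  by move=> A; rewrite prodr_const card_ord.
exact: polyfun_prod.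
Qed.

Lemma polyfun_comp (h : 'M[R]_n -> 'M[R]_n) f :
  (forall i j, polyfun (fun A => h A i j)) -> polyfun f ->
  polyfun (fun A => f (h A)).
Proof.
move=> ph; elim=> {f} [c|i j|f g _ pf _ pg|f g _ pf _ pg].
- exact: polyfun_cst.
- exact: ph.
- exact: polyfun_add.
- exact: polyfun_mul.
Qed.

Lemma polyfun_det m (h : 'M[R]_n -> 'M[R]_m) :
  (forall i j, polyfun (fun A => h A i j)) -> polyfun (fun A => \det (h A)).
Proof.
move=> ph; apply: polyfun_sum => s; apply: polyfun_mul.
  exact: polyfun_cst.
exact: polyfun_prod.
Qed.

Lemma polyfun_determinant : polyfun (determinant : 'M[R]_n -> R).
Proof. by apply: polyfun_det => i j; exact: polyfun_coord. Qed.

Lemma polyfun_mulmxl (B : 'M[R]_n) i j : polyfun (fun A => (B *m A) i j).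
Proof.
apply: (@polyfun_ext (fun A => \sum_k B i k * A k j)) => [A|].
  by rewrite mxE.
apply: polyfun_sum => k; apply: polyfun_mul; first exact: polyfun_cst.
exact: polyfun_coord.
Qed.

Lemma polyfun_mulmxr (B : 'M[R]_n) i j : polyfun (fun A => (A *m B) i j).
Proof.
apply: (@polyfun_ext (fun A => \sum_k A i k * B k j)) => [A|].
  by rewrite mxE.
apply: polyfun_sum => k; apply: polyfun_mul; first exact: polyfun_coord.
exact: polyfun_cst.
Qed.

Lemma polyfun_adj i j : polyfun (fun A : 'M[R]_n => (\adj A) i j).
Proof.
apply: (@polyfun_ext (fun A => (-1) ^+ (j + i) * \det (row' j (col' i A)))).
  by move=> A; rewrite mxE.
apply: polyfun_mul; first exact: polyfun_cst.
apply: polyfun_det => k l.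
by apply: polyfun_ext (polyfun_coord _ _ _) => A; rewrite !mxE.
Qed.

End polyfun_theory.

(** * Topology of the general linear group *)

Section topology_GL.
Variables (R : realType) (n : nat).
Local Notation G := (GL R n).
Local Notation mx := (@mx_of_GL R n).

Lemma mx_of_GL_continuous : continuous (@mx_of_GL R n : G -> 'M[R]_n).
Proof. exact: initial_continuous. Qed.

Lemma GL_nbhsP (g : G) (U : set G) :
  nbhs g U -> exists2 V, nbhs (mx_of_GL g) V & (@mx_of_GL R n) @^-1` V `<=` U.
Proof.
rewrite nbhsE => -[_ [[V oV <-] Vg] VU]; exists V => //.
exact: open_nbhs_nbhs.
Qed.

Lemma cvg_mx (T : Type) (F : set_system T) (FF : Filter F)
    (h : T -> 'M[R]_n) (A : 'M[R]_n) :
  (forall i j, h x i j @[x --> F] --> A i j) -> h x @[x --> F] --> A.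
Proof.
move=> hA V [P PA PV].
apply: (@filterS _ F _ (fun x => forall i j, P i j (h x i j))).
  by move=> x Px; apply: PV.
by apply: filter_forall => i; apply: filter_forall => j; apply: hA; exact: PA.
Qed.

Lemma continuous_to_GL (T : topologicalType) (h : T -> G) :
  (forall i j, continuous (fun x => mx_of_GL (h x) i j)) -> continuous h.
Proof.
move=> ch x U /GL_nbhsP[V Vx VU].
have {}ch : mx_of_GL (h y) @[y --> x] --> mx_of_GL (h x).
  by apply: cvg_mx => i j; exact: ch.
apply: (@filterS _ (nbhs x) _ [set y | V (mx_of_GL (h y))]).
  by move=> y; exact: VU.
exact: ch.
Qed.

Lemma polyfun_GL_continuous f : polyfun f -> continuous (fun z : G => f (mx z)).
Proof.
move=> pf z; apply: continuous_comp; first exact: mx_of_GL_continuous.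
exact: polyfun_continuous.
Qed.

Lemma closed_polyfun_zeros f : polyfun f -> closed [set z : G | f (mx z) = 0].
Proof.
move=> pf.
exact: (proj1 (continuous_closedP _) (polyfun_GL_continuous pf) _ (@closed_eq R 0)).
Qed.

Lemma closed_GL1 (z : G) : closed [set z].
Proof.
rewrite (_ : [set z] = \bigcap_(ij : 'I_n * 'I_n)
    [set x : G | mx x ij.1 ij.2 - mx z ij.1 ij.2 = 0]).
  apply: closed_bigI => -[i j] _ /=.
  apply: (@closed_polyfun_zeros (fun A => A i j - mx z i j)).
  by apply: polyfun_sub; [exact: polyfun_coord|exact: polyfun_cst].
apply/seteqP; split=> [_ -> [i j] _|x xz] /=; first by rewrite subrr.
apply: mx_of_GL_inj; apply/matrixP => i j; apply/eqP.
by rewrite -subr_eq0; apply/eqP; exact: (xz (i, j)).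
Qed.

Lemma left_translateE (g : G) (E : set G) :
  [set (g * x)%g | x in E] = [set y : G | E (g^-1 * y)%g].
Proof.
apply/seteqP; split=> [_ [x Ex <-]|y Ey] /=; first by rewrite mulKg.
by exists (g^-1 * y)%g => //; rewrite mulVKg.
Qed.

Lemma right_translateE (S : set G) (p : G) :
  right_translate S p = [set x | S (x * p^-1)%g].
Proof.
apply/seteqP; split=> [_ [x Sx <-]|x Sx] /=; first by rewrite mulgK.
by exists (x * p^-1)%g => //; rewrite mulgVK.
Qed.

Lemma left_mul_continuous (g : G) : continuous (fun y : G => (g * y)%g).
Proof.
apply: continuous_to_GL => i j.
exact: (@polyfun_GL_continuous (fun A => (mx g *m A) i j) (polyfun_mulmxl _ _ _)).
Qed.

Lemma right_mul_continuous (g : G) : continuous (fun y : G => (y * g)%g).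
Proof.
apply: continuous_to_GL => i j.
exact: (@polyfun_GL_continuous (fun A => (A *m mx g) i j) (polyfun_mulmxr _ _ _)).
Qed.

(** For small [t] the matrix [1 + t v] is invertible, and the expression below
    is then [(1 + t v)^-1 A]; in this adjugate form continuity reduces to that
    of polynomials. *)
Lemma inverse_line_cvg (v A : 'M[R]_n) :
  (\det (1%:M + p.1 *: v))^-1 *: (\adj (1%:M + p.1 *: v) *m p.2)
    @[p --> ((0 : R), A)] --> A.
Proof.
have cline (f : 'M[R]_n -> R) : polyfun f ->
    f (1%:M + p.1 *: v) @[p --> ((0 : R), A)] --> f 1%:M.
  move=> /polyfun_line[D /(_ 1%:M v)[q _ fq]].
  rewrite -[1%:M in X in _ --> X]addr0 -(scale0r v) fq.
  rewrite (_ : (fun _ => _) = (fun p : R * 'M[R]_n => q.[p.1])).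
    apply: (@cvg_comp _ _ _ fst (horner q) _ (nbhs (0 : R))).
      exact: cvg_fst.
    exact: continuous_horner.
  by apply/funext => p; rewrite fq.
apply: cvg_mx => i j.
have -> : A i j = (\det (1%:M : 'M[R]_n))^-1 *
    \sum_k (\adj (1%:M : 'M[R]_n)) i k * A k j.
  have := mul_adj_mx (1%:M : 'M[R]_n); rewrite mulmx1 det1 => ->.
  rewrite invr1 mul1r (bigD1 i)//= !mxE eqxx mul1r big1 ?addr0// => k ki.
  by rewrite mxE eq_sym (negbTE ki) mul0r.
rewrite (_ : (fun _ => _) = (fun p : R * 'M[R]_n =>
   (\det (1%:M + p.1 *: v))^-1 *
   \sum_k (\adj (1%:M + p.1 *: v)) i k * p.2 k j)); last first.
  by apply/funext => p; rewrite !mxE.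
apply: cvgM.
  apply: cvgV; first by rewrite det1 oner_neq0.
  exact: (cline _ (@polyfun_determinant R n)).
apply: cvg_big => //.
  exact: add_continuous.
move=> k _; apply: cvgM.
  by apply: (cline (fun X : 'M[R]_n => (\adj X) i k)); exact: polyfun_adj.
apply: (@cvg_comp _ _ _ snd (fun X : 'M[R]_n => X k j) _ (nbhs A)).
  exact: cvg_snd.
exact: coord_continuous.
Qed.

(** Countably many boxes with rational centres form a base of the topology,
    which is what passes from local to global null sets. *)
Definition rat_ball (c : 'M[rat]_n * nat) : set G :=
  [set x | forall i j, `|ratr (c.1 i j) - mx x i j| < c.2.+1%:R^-1].

Lemma rat_ball_nbhs (x : G) (U : set G) : nbhs x U ->
  exists2 c, rat_ball c x & rat_ball c `<=` U.
Proof.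
move=> /GL_nbhsP[V /nbhs_ballP[e /= e0 eV] VU].
have [k] := ltr_add_invr (divr_gt0 e0 (ltr0n R 2)); rewrite add0r => ke.
pose r : R := k.+1%:R^-1.
have r0 : 0 < r by rewrite invr_gt0.
have /choice[q qP] (ij : 'I_n * 'I_n) :
    exists q : rat, `|ratr q - mx x ij.1 ij.2| < r.
  have [|q] := @rat_in_itvoo R (mx x ij.1 ij.2 - r) (mx x ij.1 ij.2 + r); first by lra.
  by rewrite in_itv/= => qx; exists q; rewrite ltr_distl.
exists (\matrix_(i, j) q (i, j), k).
  by move=> i j /=; rewrite mxE; exact: (qP (i, j)).
move=> y qy; apply: VU; apply: eV; split => // i j.
have := qy i j; have := qP (i, j); rewrite /= mxE /ball/= => h1 h2.
rewrite -(subrKA (ratr (q (i, j)))) (le_lt_trans (ler_normD _ _))//.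
rewrite -/r in h1 h2 ke; rewrite distrC; lra.
Qed.

End topology_GL.

(** * Null sets for a left Haar measure *)

Section overlap.
Context d (T : measurableType d) (R : realType) (mu : {measure set T -> \bar R}).

(** Integrate the counting function of the family [A] over [W]. *)
Lemma sum_measure_overlap (W : set T) (A : nat -> set T) (D m : nat) :
  measurable W -> (forall k, measurable (A k)) -> (forall k, A k `<=` W) ->
  (forall x, W x -> (\sum_(k < m) (x \in A k) <= D)%N) ->
  (\sum_(k < m) mu (A k) <= D%:R%:E * mu W)%E.
Proof.
move=> mW mA AW AD.
have mind k : measurable_fun W (fun x => (\1_(A k) x)%:E : \bar R).
  by apply/measurable_EFinP; exact: measurable_indic.
have -> : (\sum_(k < m) mu (A k) =
    \int[mu]_(x in W) \sum_(k < m) (\1_(A k) x)%:E)%E.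
  rewrite ge0_integral_sum//.
  by apply: eq_bigr => k _; rewrite integral_indic// setIidl.
rewrite -integral_cst//; apply: ge0_le_integral => //.
- by move=> x Wx; apply: sume_ge0.
- by apply: emeasurable_sum => k; exact: mind.
- move=> x Wx; rewrite sumEFin lee_fin.
  under eq_bigr do rewrite indicE.
  by rewrite -natr_sum ler_nat AD.
Qed.

(** [m] sets of measure [mu E] that cover each point at most [D] times fit in
    [W] only if [m * mu E <= D * mu W], and [m] is arbitrary. *)
Lemma null_of_overlap (W E : set T) (A : nat -> set T) (D : nat) :
  measurable W -> (mu W < +oo)%E ->
  (forall k, measurable (A k)) -> (forall k, A k `<=` W) ->
  (forall k, mu (A k) = mu E) ->
  (forall m x, W x -> (\sum_(k < m) (x \in A k) <= D)%N) ->
  mu E = 0%E.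
Proof.
move=> mW Woo mA AW AE AD.
have le m : (m%:R%:E * mu E <= D%:R%:E * mu W)%E.
  apply: le_trans (@sum_measure_overlap W A D m mW mA AW (AD m)).
  under eq_bigr do rewrite AE.
  by rewrite sumr_const card_ord mule_natl.
have Wfin : mu W \is a fin_num by rewrite ge0_fin_numE.
have Efin : mu E \is a fin_num.
  rewrite ge0_fin_numE//; have := le 1%N; rewrite mul1e => /le_lt_trans; apply.
  by rewrite lte_mul_pinfty// lee_fin.
apply/eqP; rewrite eq_le measure_ge0 andbT leNgt; apply/negP => E0.
have E0' : 0 < fine (mu E) by rewrite fine_gt0// E0 -ge0_fin_numE.
pose m := (Num.truncn (D%:R * fine (mu W) / fine (mu E))).+1.
have := le m; rewrite -(fineK Wfin) -(fineK Efin) -!EFinM lee_fin leNgt.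
by rewrite -ltr_pdivrMr// truncnS_gt.
Qed.

Lemma negligible_bigcup_count (I : countType) (B : I -> set T) :
  (forall i, mu.-negligible (B i)) -> mu.-negligible (\bigcup_i B i).
Proof.
move=> B0; pose C k := if unpickle k is Some i then B i else set0.
apply: (@negligibleS _ _ _ _ (\bigcup_k C k)).
  by move=> x [i _ Bx]; exists (pickle i) => //; rewrite /C pickleK.
apply: negligible_bigcup => k; rewrite /C.
by case: unpickle => [i|]; [exact: B0|exact: negligible_set0].
Qed.

End overlap.

Section haar_null.
Variables (R : realType) (n : nat).
Local Notation G := (GL R n).
Local Notation mx := (@mx_of_GL R n).
Variable lambda : {measure set (borelType G) -> \bar R}.
Hypothesis haar : left_haar_measure lambda.

Lemma open_GL_measurable (U : set G) : open U -> measurable (U : set (borelType G)).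
Proof. exact: sub_sigma_algebra. Qed.

Lemma closed_GL_measurable (U : set G) :
  closed U -> measurable (U : set (borelType G)).
Proof.
move=> cU; rewrite -(setCK U); apply: measurableC.
by apply: open_GL_measurable; exact: closed_openC.
Qed.

(** Outer regularity at a point, which is compact. *)
Lemma haar_locally_finite (z : G) :
  exists W : set G, [/\ open W, W z & (lambda W < +oo)%E].
Proof.
have [[lcpt outer _] _ _] := haar.
have : (lambda [set z] < +oo)%E by apply: lcpt; exact: compact_set1.
rewrite outer; last by apply: closed_GL_measurable; exact: closed_GL1.
move=> /ereal_inf_lt[_ [W [oW zW] <-] Woo]; exists W; split => //.
exact: zW.
Qed.

(** The translates [(1 + t k * v)^-1 (U & Z)], [k] natural, stay in the open
    set [V] of finite measure, and a point of [V] lies in at most [D] of them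
    because it gives a nonzero polynomial in [t] of size at most [D]. *)
Lemma haar_zeros_local f (g z : G) : polyfun f -> f (mx g) != 0 ->
  exists U : set G, [/\ open U, U z &
    lambda (U `&` [set x : G | f (mx x) = 0]) = 0%E].
Proof.
move=> pf fg0.
set Z := [set x : G | f (mx x) = 0].
have [W [oW Wz Woo]] := haar_locally_finite z.
(* [(1 + v) z = g], so that [f] does not vanish there. *)
pose v : 'M[R]_n := mx g *m invmx (mx z) - 1%:M.
pose c (t : R) := 1%:M + t *: v.
pose fv (y : 'M[R]_n) := f (c 1 *m y).
have pfv : polyfun fv.
  by apply: polyfun_comp pf => i j; exact: polyfun_mulmxl.
pose V : set G := W `&` [set y | fv (mx y) != 0].
have Vz : nbhs z V.
  apply: filterI; first exact: open_nbhs_nbhs.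
  apply: (@polyfun_GL_continuous _ _ _ pfv z [set r | r != 0]).
  apply: open_nbhs_nbhs; split; first exact: open_neq.
  rewrite /= /fv /c scale1r addrC subrK -mulmxA mulVmx ?mulmx1//.
  exact: mx_of_GL_unit.
have [V' V'z V'V] := GL_nbhsP Vz.
have [[P1 P2] /= [P1_0 P2_z] P12] := inverse_line_cvg v V'z.
have detc_near : nbhs (0 : R) [set t | \det (c t) != 0].
  have /polyfun_line[_ /(_ 1%:M v)[q _ qE]] := @polyfun_determinant R n.
  have q0 : q.[0] != 0 by rewrite -qE scale0r addr0 det1 oner_neq0.
  have nq : nbhs q.[0] [set r : R | r != 0].
    by apply: open_nbhs_nbhs; split => //; exact: open_neq.
  apply: (@filterS _ (nbhs (0 : R)) _ (horner q @^-1` [set r | r != 0])).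
    by move=> t /=; rewrite -qE.
  exact: (@continuous_horner R q 0 _ nq).
have : nbhs (0 : R) (P1 `&` [set t | \det (c t) != 0]) by exact: filterI.
move=> /nbhs_ballP[e /= e0 eP].
(* [k.+2] keeps [t k] strictly inside the ball of radius [e]. *)
pose t (k : nat) : R := e / k.+2%:R.
have tP k : P1 (t k) /\ \det (c (t k)) != 0.
  apply: eP; rewrite /ball/= sub0r normrN ger0_norm ?divr_ge0 ?(ltW e0)//.
  by rewrite ltr_pdivrMr// ltr_pMr// ltr1n.
have unit_c k : c (t k) \in unitmx by rewrite unitmxE unitfE; have [] := tP k.
pose x k : G := toGL (unit_c k).
pose U : set G := mx @^-1` P2°.
have oU : open U.
  by apply: open_comp (open_interior _) => y _; exact: mx_of_GL_continuous.
exists U; split => //.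
pose E := U `&` Z.
have mE : measurable (E : set (borelType G)).
  apply: measurableI; first exact: open_GL_measurable.
  by apply: closed_GL_measurable; exact: closed_polyfun_zeros.
pose A k := [set ((x k)^-1 * y)%g | y in E].
have AV k : A k `<=` V.
  move=> _ [y [Uy _] <-]; apply: V'V => /=.
  have := P12 (t k, mx y) (conj (proj1 (tP k)) (interior_subset Uy)).
  rewrite /= -/(c (t k)) scalemxAl.
  by rewrite [X in V' (X *m _)](_ : _ = invmx (c (t k))) // /invmx unit_c.
have mA k : measurable (A k : set (borelType G)).
  rewrite /A left_translateE invgK.
  have -> : [set y | E (x k * y)%g] =
      [set y | U (x k * y)%g] `&` [set y | Z (x k * y)%g] by [].
  apply: measurableI.
    apply: open_GL_measurable; apply: (@open_comp _ _ (fun y => (x k * y)%g)) => //.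
    by move=> y _; exact: left_mul_continuous.
  apply: closed_GL_measurable.
  exact: (proj1 (continuous_closedP _) (@left_mul_continuous _ _ (x k)) _
           (closed_polyfun_zeros pf)).
have [D fD] := polyfun_line pf.
have [_ _ invar] := haar.
apply: (@null_of_overlap _ _ _ lambda W E A D) => //.
- exact: open_GL_measurable.
- by move=> k y /AV[].
- by move=> k; exact: invar.
- move=> m y Wy; have [Vy|nVy] := pselect (V y); last first.
    by rewrite big1// => k _; rewrite memNset// => /AV.
  have [p sp pE] := fD (mx y) (v *m mx y).
  have pE' s : f (c s *m mx y) = p.[s].
    by rewrite -pE /c mulmxDl mul1mx scalemxAl.
  have p0 : p != 0.
    (* [p] takes the value [fv y] at 1. *)
    apply/eqP => p0; have [_ /eqP] := Vy; apply.
    by rewrite /fv pE' p0 horner0.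
  pose s := [seq t k | k <- iota 0 m & y \in A k].
  have -> : (\sum_(k < m) (y \in A k) = size s)%N.
    rewrite size_map size_filter -sum1_count [RHS]big_mkcond/=.
    rewrite -(big_mkord predT (fun k => nat_of_bool (y \in A k))).
    by rewrite /index_iota subn0; apply: eq_bigr => k _; case: (y \in A k).
  apply: leq_trans sp; apply: ltnW; apply: max_poly_roots => //.
    apply/allP => _ /mapP[k + ->]; rewrite mem_filter => /andP[yA _].
    move: yA; rewrite inE /A left_translateE invgK => -[_ /= fxy].
    by rewrite /root -pE'; apply/eqP.
  rewrite map_inj_uniq ?filter_uniq ?iota_uniq// => a b.
  move=> /(mulfI (lt0r_neq0 e0))/invr_inj/eqP.
  by rewrite eqr_nat => /eqP[].
Qed.

Lemma locally_negligible (Z : set G) :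
  (forall z : G, exists U : set G,
     [/\ open U, U z & lambda.-negligible (U `&` Z : set (borelType G))]) ->
  lambda.-negligible (Z : set (borelType G)).
Proof.
move=> locZ.
(* The boxes that meet [Z] in a null set cover [Z]. *)
pose N (c : 'M[rat]_n * nat) : set (borelType G) :=
  [set x | [/\ lambda.-negligible (rat_ball c `&` Z : set (borelType G)),
               rat_ball c x & Z x]].
have N0 c : lambda.-negligible (N c).
  have [negl|nnegl] := pselect
      (lambda.-negligible (rat_ball c `&` Z : set (borelType G))).
    by apply: negligibleS negl => x [].
  rewrite (_ : N c = set0); first exact: negligible_set0.
  by apply/seteqP; split => // x [].
apply: negligibleS (negligible_bigcup_count N0).
move=> z Zz; have [U [oU Uz U0]] := locZ z.
have [c cz cU] := rat_ball_nbhs (open_nbhs_nbhs (conj oU Uz)).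
exists c => //; split => //.
by apply: negligibleS U0 => y [cy Zy]; split => //; exact: cU.
Qed.

Lemma haar_zeros f (g : G) : polyfun f -> f (mx g) != 0 ->
  lambda.-negligible ([set x : G | f (mx x) = 0] : set (borelType G)).
Proof.
move=> pf fg; apply: locally_negligible => z.
have [U [oU Uz U0]] := haar_zeros_local z pf fg.
exists U; split => //; apply/negligibleP => //.
apply: measurableI; first exact: open_GL_measurable.
by apply: closed_GL_measurable; exact: closed_polyfun_zeros.
Qed.

End haar_null.

(** * Gram matrices of upper triangular matrices *)

Section upper_triangular.
Variables (R : realType) (n : nat).
Implicit Types (T : 'M[R]_n) (i j : 'I_n).

Definition upper T := forall i j, (j < i)%N -> T i j = 0.

Definition lead_minor (m : nat) (mn : (m <= n)%N) (c : 'I_m -> 'I_n)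
    (S : 'M[R]_n) : R :=
  \det (\matrix_(a < m, b < m) S (widen_ord mn a) (c b)).

Lemma det_upper m (A : 'M[R]_m) :
  (forall a b : 'I_m, (b < a)%N -> A a b = 0) -> \det A = \prod_(a < m) A a a.
Proof.
move=> A0; rewrite -det_tr det_trig; last first.
  by apply/is_trig_mxP => a b ab; rewrite mxE A0.
by apply: eq_bigr => a _; rewrite mxE.
Qed.

(** As [T] is upper triangular, the entries of [T^T T] in its first [m] rows
    involve only the first [m] rows of [T], whence a product of two square
    matrices of size [m]. *)
Lemma lead_minor_gram T m (mn : (m <= n)%N) (c : 'I_m -> 'I_n) : upper T ->
  lead_minor mn c (T^T *m T) =
  (\prod_(a < m) T (widen_ord mn a) (widen_ord mn a)) *
  \det (\matrix_(a < m, b < m) T (widen_ord mn a) (c b)).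
Proof.
move=> uT; rewrite /lead_minor.
pose A := \matrix_(a < m, b < m) T (widen_ord mn a) (widen_ord mn b).
have -> : \prod_(a < m) T (widen_ord mn a) (widen_ord mn a) = \det A^T.
  rewrite det_tr det_upper => [|a b ba]; last by rewrite mxE uT.
  by apply: eq_bigr => a _; rewrite mxE.
rewrite -det_mulmx; congr (\det _); apply/matrixP => a b; rewrite !mxE.
rewrite (bigID (fun l : 'I_n => (l < m)%N))/= [X in _ + X]big1 => [|l lm].
  rewrite addr0 (big_ord_narrow mn); apply: eq_bigr => l _.
  by rewrite !mxE.
by rewrite mxE uT ?mul0r//= (leq_trans (ltn_ord a))// leqNgt.
Qed.

Definition prev_minor i (S : 'M[R]_n) : R :=
  lead_minor (ltnW (ltn_ord i)) (widen_ord (ltnW (ltn_ord i))) S.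

(** The last column of the leading minor of size [i.+1] is replaced by column
    [j]; [j = i] gives the leading minor itself. *)
Definition bordered_minor i j (S : 'M[R]_n) : R :=
  lead_minor (ltn_ord i)
    (fun b => if b == ord_max then j else widen_ord (ltn_ord i) b) S.

Lemma prev_minor_gram T i : upper T ->
  prev_minor i (T^T *m T) = (\prod_(l < n | (l < i)%N) T l l) ^+ 2.
Proof.
move=> uT; rewrite /prev_minor lead_minor_gram// det_upper => [|a b ba].
  rewrite (big_ord_narrow (ltnW (ltn_ord i))) expr2; congr (_ * _).
  by apply: eq_bigr => a _; rewrite mxE.
by rewrite mxE uT.
Qed.

(** Together with [prev_minor_gram], this reads off the entries of [T] from
    its Gram matrix, as quotients of minors. *)
Lemma bordered_minor_gram T i j : upper T ->
  bordered_minor i j (T^T *m T) = prev_minor i (T^T *m T) * T i i * T i j.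
Proof.
move=> uT; rewrite prev_minor_gram// (big_ord_narrow (ltnW (ltn_ord i))).
rewrite /bordered_minor lead_minor_gram// det_upper => [|a b ba].
  rewrite !big_ord_recr/= !mxE eqxx.
  have -> : widen_ord (ltn_ord i) ord_max = i by exact: val_inj.
  have wi (a : 'I_i) : widen_ord (ltn_ord i) (widen_ord (leqnSn i) a) =
      widen_ord (ltnW (ltn_ord i)) a by exact: val_inj.
  under eq_bigr do rewrite wi.
  under [X in _ * (X * _)]eq_bigr => a _.
    rewrite mxE wi (_ : (_ == ord_max) = false); first over.
    by apply/negbTE; rewrite -val_eqE/= ltn_eqF.
  by rewrite expr2 !mulrA; congr (_ * _); rewrite mulrAC.
rewrite mxE (_ : (b == ord_max) = false) ?uT//.
by apply/negbTE; rewrite -val_eqE/= ltn_eqF// (leq_trans ba)// -ltnS.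
Qed.

Lemma orthogonal_gram (k T : 'M[R]_n) : orthogonal_mx k ->
  (k *m T)^T *m (k *m T) = T^T *m T.
Proof. by move=> ok; rewrite trmx_mul -mulmxA (mulmxA k^T) ok mul1mx. Qed.

Lemma prev_minor_gt0 T i : upper T -> (forall i, 0 < T i i) ->
  0 < prev_minor i (T^T *m T).
Proof.
by move=> uT T0; rewrite prev_minor_gram// exprn_gt0// prodr_gt0.
Qed.

Lemma upper_gram_inj T T' : upper T -> upper T' ->
  (forall i, 0 < T i i) -> (forall i, 0 < T' i i) ->
  T^T *m T = T'^T *m T' -> T = T'.
Proof.
move=> uT uT' T0 T'0 TT'.
have row i j : T i i * T i j = T' i i * T' i j.
  have := bordered_minor_gram i j uT; rewrite TT' bordered_minor_gram//.
  rewrite -!mulrA => /mulfI -> //.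
  by rewrite gt_eqF// prev_minor_gt0.
have diag i : T i i = T' i i.
  have := row i i; rewrite -!expr2 => /eqP.
  by rewrite eqrXn2// ?ltW// => /eqP.
apply/matrixP => i j; have := row i j; rewrite diag => /mulfI; apply.
by rewrite gt_eqF.
Qed.

Lemma polyfun_lead_minor (h : 'M[R]_n -> 'M[R]_n) m (mn : (m <= n)%N) c :
  (forall i j, polyfun (fun A => h A i j)) ->
  polyfun (fun A => lead_minor mn c (h A)).
Proof.
by move=> ph; apply: polyfun_det => a b; apply: polyfun_ext (ph _ _) => A; rewrite mxE.
Qed.

End upper_triangular.

(** Induction on the size: the first row of [T] is forced, and the Schur
    complement [S'] of the top left entry is again positive definite, since its
    quadratic form at [x] is that of [S] at [x] completed by the first coordinate
    that minimises it. *)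
Lemma cholesky (R : realType) (n : nat) (S : 'M[R]_n) :
  S^T = S -> (forall x : 'cV[R]_n, x != 0 -> 0 < (x^T *m S *m x) 0 0) ->
  exists T, [/\ upper T, forall i, 0 < T i i & T^T *m T = S].
Proof.
elim: n S => [|n ih] S symS posS.
  by exists S; split=> [[//]|[//]|]; apply/matrixP => -[].
change n.+1 with (1 + n)%N in S, symS, posS |- *.
pose a := ulsubmx S 0 0; pose b : 'rV[R]_n := ursubmx S.
have Sa : ulsubmx S = a%:M by rewrite [LHS]mx11_scalar.
have Sb : dlsubmx S = b^T by rewrite -{1}symS -trmx_ursub.
have SE : S = block_mx a%:M b b^T (drsubmx S) by rewrite -Sa -Sb submxK.
have a0 : 0 < a.
  have := posS (col_mx 1%:M 0); rewrite {1}SE tr_col_mx mul_row_block.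
  rewrite mul_row_col trmx1 trmx0 !mul1mx !mul0mx !mulmx0 !addr0 mulmx1.
  rewrite mxE eqxx mulr1n; apply.
  rewrite col_mx_eq0 negb_and; apply/orP; left.
  by apply/eqP => /matrixP/(_ 0 0)/eqP; rewrite !mxE oner_eq0.
pose S' := drsubmx S - a^-1 *: (b^T *m b).
have symS' : S'^T = S'.
  by rewrite /S' linearB/= linearZ/= trmx_mul trmxK trmx_drsub symS.
have [|T' [uT' T'0 TE]] := ih S' symS'.
  move=> x x0; pose X : 'cV[R]_(1 + n) := col_mx (- (a^-1 *: (b *m x))) x.
  have /posS : X != 0.
    by rewrite col_mx_eq0 negb_and x0 orbT.
  rewrite -mulmxA {1}SE mul_block_col.
  rewrite mul_scalar_mx scalerN scalerA divff ?gt_eqF// scale1r addNr.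
  rewrite mulmxN -scalemxAr addrC -mulmxA.
  have -> : drsubmx S *m x - a^-1 *: (b^T *m (b *m x)) = S' *m x.
    by rewrite mulmxBl -scalemxAl mulmxA.
  by rewrite tr_col_mx mul_row_col mulmx0 add0r mulmxA.
pose r := Num.sqrt a.
have r0 : 0 < r by rewrite sqrtr_gt0.
have rr : r * r = a by rewrite -expr2 sqr_sqrtr// ltW.
exists (block_mx r%:M (r^-1 *: b) 0 T'); split.
- move=> i j; rewrite -(fintype.splitK i) -(fintype.splitK j).
  case: (fintype.split i) => i'; case: (fintype.split j) => j' /=.
  + by rewrite !ord1.
  + by move=> /leq_trans/(_ (ltnW (ltn_ord i'))); rewrite ltnNge leq_addr.
  + by rewrite block_mxEdl mxE.
  + by rewrite block_mxEdr ltn_add2l => /uT'.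
- move=> i; rewrite -(fintype.splitK i); case: (fintype.split i) => i' /=.
  + by rewrite block_mxEul ord1 mxE eqxx mulr1n.
  + by rewrite block_mxEdr.
rewrite tr_block_mx mulmx_block trmx0 !mul0mx !mulmx0 !addr0 TE.
rewrite tr_scalar_mx !mul_scalar_mx mul_mx_scalar scale_scalar_mx rr.
have rK (p q : nat) (B : 'M[R]_(p, q)) : r *: (r^-1 *: B) = B.
  by rewrite scalerA divff ?gt_eqF// scale1r.
have -> : (r^-1 *: b)^T = r^-1 *: b^T by rewrite linearZ.
rewrite !rK -scalemxAl -scalemxAr scalerA -invfM rr.
by rewrite /S' addrC subrK -SE.
Qed.

(** * Fundamental domains for the scalar and the unipotent part *)

(** If [T^T T = A^T A] then [A T^-1] is orthogonal. *)
Lemma qr_decomposition (R : realType) (n : nat) (A : 'M[R]_n) : A \in unitmx ->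
  exists k T, [/\ orthogonal_mx k, upper T, forall i, 0 < T i i & A = k *m T].
Proof.
move=> uA.
have [||T [uT T0 TT]] := @cholesky R n (A^T *m A).
- by rewrite trmx_mul trmxK.
- move=> x x0; have Ax0 : A *m x != 0.
    by apply: contra_neq x0 => Ax; rewrite -(mulKmx uA x) Ax mulmx0.
  rewrite mulmxA -trmx_mul -mulmxA mxE.
  have [i Axi] : exists i, (A *m x) i 0 != 0.
    apply/existsP; apply: contraNT Ax0; rewrite negb_exists => /forallP Ax0.
    apply/eqP/matrixP => i j; rewrite ord1 [RHS]mxE; apply/eqP.
    by have := Ax0 i; rewrite negbK.
  rewrite (bigD1 i)//= mxE ltr_wpDr//.
    by apply: sumr_ge0 => j _; rewrite mxE -expr2 sqr_ge0.
  by rewrite -expr2 exprn_even_gt0.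
have unitT : T \in unitmx by apply: upper_unitmx => // i; rewrite gt_eqF.
exists (A *m invmx T), T; split => //; last by rewrite mulmxKV.
rewrite /orthogonal_mx trmx_mul trmx_inv -mulmxA (mulmxA A^T) -TT.
rewrite -mulmxA mulmxV// mulmx1 mulVmx//.
by rewrite unitmx_tr.
Qed.

Lemma dyadic_decomposition (R : realType) (x : R) : 0 < x ->
  exists2 sk : R * int, sk.1 \in `[1, 2[ & x = sk.1 * 2 ^ sk.2.
Proof.
move=> x0; pose k := Num.floor (ln x / ln 2).
have ln2 : 0 < ln (2 : R) by rewrite ln_gt0// ltr1n.
have pow2 (m : int) : (2 : R) ^ m = expR (m%:~R * ln 2).
  rewrite -powR_intmul//.
  by rewrite /powR pnatr_eq0.
have p0 : 0 < (2 : R) ^ k by rewrite exprz_gt0.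
exists (x / 2 ^ k, k) => /=; last by rewrite divfK ?gt_eqF.
rewrite in_itv/= ler_pdivlMr// mul1r ltr_pdivrMr//.
have -> : 2 * 2 ^ k = 2 ^ (k + 1) :> R by rewrite expfzDr// expr1z mulrC.
rewrite !pow2 -(lnK x0) ler_expR ltr_expR.
by rewrite -ler_pdivlMr// -ltr_pdivrMr// floor_itv.
Qed.

Lemma dyadic_uniq (R : realType) (s s' : R) (k k' : int) :
  s \in `[1, 2[ -> s' \in `[1, 2[ -> s * 2 ^ k = s' * 2 ^ k' -> s = s' /\ k = k'.
Proof.
wlog kk' : s s' k k' / k <= k'.
  move=> hw s1 s'1 e; have [kk'|/ltW kk'] := leP k k'; first exact: hw.
  by have [-> ->] := hw _ _ _ _ kk' s'1 s1 (esym e).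
rewrite !in_itv/= => /andP[s1 s2] /andP[s'1 s'2] e.
have p0 (m : int) : 0 < (2 : R) ^ m by rewrite exprz_gt0.
have [kE|ltk] := eqVneq k k'.
  by split => //; move: e; rewrite kE => /(mulIf (lt0r_neq0 (p0 _))).
have lek : k + 1 <= k' by rewrite lezD1 lt_neqAle ltk.
have : s * 2 ^ k < s' * 2 ^ k'.
  rewrite (@lt_le_trans _ _ (2 ^ (k + 1)))//.
    by rewrite expfzDr// expr1z mulrC ltr_pM2l.
  rewrite (@le_trans _ _ (2 ^ k'))//; last by rewrite ler_peMl// ltW.
  by rewrite ler_weXz2l// ler1n.
by rewrite e ltxx.
Qed.

Lemma frac_uniq (R : realType) (y y' : R) (m m' : int) :
  y \in `[0, 1[ -> y' \in `[0, 1[ -> y + m%:~R = y' + m'%:~R -> y = y' /\ m = m'.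
Proof.
rewrite !in_itv/= => /andP[y0 y1] /andP[y'0 y'1] e.
have mm : m = m'.
  apply: le_anti; rewrite -!ltzD1 -!(ltr_int R) !intrD.
  by apply/andP; split; lra.
by split => //; move: e; rewrite mm => /addIr.
Qed.

Section unipotent.
Variables (R : realType) (n : nat).
Implicit Types (y U : 'I_n -> 'I_n -> R) (mu : 'I_n -> 'I_n -> int).

(** The entry [(i, j)], [i < j], of the product of the unipotent upper triangular
    matrices with off-diagonal entries [y] and [mu]. *)
Definition unip_mul y mu (i j : 'I_n) : R :=
  y i j + (mu i j)%:~R +
  \sum_(l < n | (i < l)%N && (l < j)%N) y i l * (mu l j)%:~R.

Lemma mul_z_q_mx (w : 'I_n -> R) y (kappa : 'I_n -> int) mu i j :
  (z_mx w y *m q_mx R kappa mu) i j =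
  if i == j then w i * 2 ^ kappa i
  else if (i < j)%N then w i * 2 ^ kappa j * unip_mul y mu i j else 0.
Proof.
rewrite mxE.
have z0 (l : 'I_n) : (l < i)%N -> z_mx w y i l = 0.
  by move=> li; rewrite mxE -val_eqE/= gtn_eqF// ltnNge ltnW.
have q0 (l : 'I_n) : (j < l)%N -> q_mx R kappa mu l j = 0.
  by move=> jl; rewrite mxE -val_eqE/= gtn_eqF// ltnNge ltnW.
have vanish (l : 'I_n) : ~~ ((i <= l)%N && (l <= j)%N) ->
    z_mx w y i l * q_mx R kappa mu l j = 0.
  by rewrite negb_and -!ltnNge => /orP[/z0 ->|/q0 ->]; rewrite ?mul0r ?mulr0.
have [ij|ij] := eqVneq i j; first subst j.
  rewrite (bigD1 i)//= big1 => [|l li]; first by rewrite addr0 !mxE eqxx.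
  by apply: vanish; rewrite -eqn_leq eq_sym val_eqE.
have [ltij|geij] := ltnP i j; last first.
  rewrite big1// => l _; apply: vanish; apply: contra ij => /andP[il lj].
  by rewrite -val_eqE eqn_leq geij (leq_trans il).
rewrite (bigD1 i)//= (bigD1 j) 1?eq_sym//=.
rewrite (bigID (fun l : 'I_n => (i < l)%N && (l < j)%N))/=.
rewrite [X in _ + (_ + (_ + X))]big1 => [|l /andP[/andP[li lj]]]; last first.
  move=> h; apply: vanish; apply: contra h => /andP[il' lj'].
  by rewrite !ltn_neqAle il' lj' !andbT eq_sym !val_eqE li lj.
rewrite addr0 /unip_mul !mxE !eqxx (negbTE ij) ltij.
rewrite addrA !mulrDr addrC [in RHS]addrC; congr (_ + _).
  rewrite mulr_sumr; apply: eq_big => l.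
    rewrite -!val_eqE andbC; case: (ltnP i l) => //= il; case: (ltnP l j) => //= lj.
    by rewrite gtn_eqF// ltn_eqF.
  move=> /andP[_ /andP[il lj]].
  by rewrite !mxE -!val_eqE/= !ltn_eqF// il lj -!mulrA; congr (_ * _); rewrite mulrCA.
by rewrite addrC -!mulrA; congr (_ * _ + _ * _); rewrite mulrC.
Qed.

(** The entry [(i, j)] equals [y i j + mu i j] plus terms with indices closer to
    the diagonal, so fractional and integral parts are found diagonal by
    diagonal. *)
Lemma unip_decomposition U : exists y mu,
  (forall i j, y i j \in `[0, 1[) /\
  (forall i j : 'I_n, (i < j)%N -> unip_mul y mu i j = U i j).
Proof.
suff H : forall d, exists y mu, (forall i j, y i j \in `[0, 1[) /\
    (forall i j : 'I_n, (i < j < i + d)%N -> unip_mul y mu i j = U i j).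
  have [y [mu [y01 yU]]] := H n; exists y, mu; split => // i j ij.
  by apply: yU; rewrite ij ltn_addl.
elim=> [|d [y [mu [y01 yU]]]].
  exists (fun _ _ => 0), (fun _ _ => 0); split => [i j|i j].
    by rewrite in_itv/= lexx ltr01.
  by rewrite addn0 => /andP[/ltn_trans h /h]; rewrite ltnn.
pose c i j := U i j - \sum_(l < n | (i < l)%N && (l < j)%N) y i l * (mu l j)%:~R.
pose y' (i j : 'I_n) :=
  if (j == i + d :> nat)%N then c i j - (Num.floor (c i j))%:~R else y i j.
pose mu' (i j : 'I_n) := if (j == i + d :> nat)%N then Num.floor (c i j) else mu i j.
exists y', mu'; split => i j.
  rewrite /y'; case: ifP => // _; rewrite in_itv/=.
  by have := floor_itv (c i j); rewrite intrD; lra.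
move=> /andP[ij]; rewrite addnS ltnS => jd.
have mid (l : 'I_n) : (i < l)%N && (l < j)%N ->
    y' i l * (mu' l j)%:~R = y i l * (mu l j)%:~R.
  move=> /andP[il lj]; rewrite /y' /mu' !ltn_eqF//.
    by rewrite (leq_ltn_trans jd)// ltn_add2r.
  by rewrite (leq_trans lj).
rewrite /unip_mul (eq_bigr _ mid) /y' /mu'.
have [jE|jnd] := eqVneq (j : nat) (i + d)%N.
  by rewrite subrK /c subrK.
by rewrite -yU// ij ltn_neqAle jnd.
Qed.

Lemma unip_uniq y y' mu mu' :
  (forall i j : 'I_n, (i < j)%N -> y i j \in `[0, 1[) ->
  (forall i j : 'I_n, (i < j)%N -> y' i j \in `[0, 1[) ->
  (forall i j : 'I_n, (i < j)%N -> unip_mul y mu i j = unip_mul y' mu' i j) ->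
  forall i j : 'I_n, (i < j)%N -> y i j = y' i j /\ mu i j = mu' i j.
Proof.
move=> y01 y'01 e i j; have [d] := ubnP (j - i)%N.
elim: d i j => // d ih i j ltd ij; have := e i j ij; rewrite /unip_mul.
rewrite [in X in X = _](eq_bigr (fun l => y' i l * (mu' l j)%:~R)) => [|l].
  by move/addIr; apply: frac_uniq; [exact: y01|exact: y'01].
move=> /andP[il lj].
have [-> _] : y i l = y' i l /\ mu i l = mu' i l.
  by apply: ih => //; rewrite -ltnS (leq_trans _ ltd)// ltnS ltn_sub2r.
have [_ -> //] : y l j = y' l j /\ mu l j = mu' l j.
by apply: ih => //; rewrite -ltnS (leq_trans _ ltd)// ltnS ltn_sub2l.
Qed.

End unipotent.

(** * The tiling *)

Section coordinates.
Variables (R : realType) (n : nat).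
Hypothesis n_gt0 : (0 < n)%N.
Implicit Types (w : 'I_n -> R) (y : 'I_n -> 'I_n -> R).

Lemma last_entryP w : (forall i, w i != 0) ->
  (forall i : 'I_n, i.+1 = n -> w i = \prod_(j < n | (j.+1 < n)%N) (w j)^-1) <->
  \prod_i w i = 1.
Proof.
move=> w0; have n1n : (n.-1 < n)%N by rewrite prednK.
pose l := Ordinal n1n.
have lastE (i : 'I_n) : i.+1 = n -> i = l.
  by move=> iE; apply: val_inj; rewrite /= -[in RHS]iE.
have notlast (i : 'I_n) : (i.+1 < n)%N = (i != l).
  rewrite -val_eqE/= ltn_neqAle ltn_ord andbT; congr (~~ _).
  by rewrite -[RHS]eqSS prednK.
have prod_neq0 : \prod_(j < n | (j.+1 < n)%N) w j != 0 by apply/prodf_neq0.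
have -> : \prod_i w i = w l * \prod_(j < n | (j.+1 < n)%N) w j.
  by rewrite (bigD1 l)//=; congr (_ * _); apply: eq_bigl => i; rewrite notlast.
rewrite prodfV; split=> [wl|wl i /lastE->].
  by rewrite wl/= ?prednK// mulVf.
by apply: (mulIf prod_neq0); rewrite mulVf.
Qed.

Lemma w_gt0 w : (forall i : 'I_n, (i.+1 < n)%N -> w i \in `[1, 2[) ->
  (forall i : 'I_n, i.+1 = n -> w i = \prod_(j < n | (j.+1 < n)%N) (w j)^-1) ->
  forall i, 0 < w i.
Proof.
move=> w12 wn.
have wlt (i : 'I_n) : (i.+1 < n)%N -> 0 < w i.
  by move=> /w12; rewrite in_itv/= => /andP[/(lt_le_trans ltr01)].
move=> i; have [/wlt//|ni] := ltnP i.+1 n.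
rewrite wn; last by apply/eqP; rewrite eqn_leq ltn_ord.
by apply: prodr_gt0 => j /wlt; rewrite invr_gt0.
Qed.

Lemma prod_pow2_eq1 (kappa : 'I_n -> int) :
  (forall i : 'I_n, i.+1 = n ->
     kappa i = - \sum_(j < n | (j.+1 < n)%N) kappa j) ->
  \prod_i (2 : R) ^ kappa i = 1.
Proof.
move=> kn; apply/last_entryP => [i|i /kn->]; first by rewrite expfz_neq0.
rewrite prodfV -invr_expz; congr (_^-1).
by apply: (big_morph (fun m : int => (2 : R) ^ m)) => // a b; rewrite expfzDr.
Qed.

(** Scaling the triangular factor by the [n]-th root of its determinant makes
    the diagonal [w] have product 1. *)
Lemma iwasawa (A : 'M[R]_n) : A \in unitmx -> exists s k w y,
  [/\ 0 < s, orthogonal_mx k, forall i, 0 < w i, \prod_i w i = 1 &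
      A = s *: (k *m z_mx w y)].
Proof.
move=> /qr_decomposition[k [T [ok uT T0 ->]]].
pose s := (\prod_i T i i) `^ n%:R^-1.
have s0 : 0 < s by apply: powR_gt0; apply: prodr_gt0 => i _; exact: T0.
exists s, k, (fun i => T i i / s), (fun i j => T i j / T i i); split => //.
- by move=> i; rewrite divr_gt0.
- rewrite big_split/= prodr_const card_ord exprVn -powR_mulrn ?ltW//.
  rewrite -powRrM mulVf ?pnatr_eq0 -?lt0n// powRr1 ?prodr_ge0// => [|i _].
    by rewrite divff// gt_eqF// prodr_gt0.
  exact: ltW.
rewrite scalemxAr; congr (_ *m _); apply/matrixP => i j; rewrite !mxE.
have [<-|ij] := eqVneq i j; first by rewrite mulrC divfK// gt_eqF.
have [ltij|jlei] := ltnP i j.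
  rewrite [T i i / s]mulrC !mulrA divff ?gt_eqF// mul1r mulrAC divff ?mul1r//.
  by rewrite gt_eqF.
by rewrite mulr0 uT// ltn_neqAle eq_sym val_eqE ij.
Qed.

Lemma tiling_cover (A : 'M[R]_n) : A \in unitmx ->
  exists f p, [/\ F_mx f, P_mx p & A = f *m p].
Proof.
move=> /iwasawa[r [k [v [u [r0 ok v0 prodv ->]]]]].
have [[s l]/= s12 rE] := dyadic_decomposition r0.
have /choice[wk wkP] i : exists sk : R * int,
    (sk.1 \in `[1, 2[) /\ v i = sk.1 * 2 ^ sk.2.
  by have [sk] := dyadic_decomposition (v0 i); exists sk.
pose w (i : 'I_n) : R := if (i.+1 < n)%N then (wk i).1
  else \prod_(j < n | (j.+1 < n)%N) (wk j).1^-1.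
pose kappa (i : 'I_n) : int := if (i.+1 < n)%N then (wk i).2
  else - \sum_(j < n | (j.+1 < n)%N) (wk j).2.
have w12 (i : 'I_n) : (i.+1 < n)%N -> w i \in `[1, 2[.
  by move=> h; rewrite /w h; have [] := wkP i.
have wn (i : 'I_n) : i.+1 = n -> w i = \prod_(j < n | (j.+1 < n)%N) (w j)^-1.
  move=> h; rewrite /w h ltnn; apply: eq_bigr => j jn.
  by rewrite jn.
have kn (i : 'I_n) : i.+1 = n -> kappa i = - \sum_(j < n | (j.+1 < n)%N) kappa j.
  move=> h; rewrite /kappa h ltnn; congr (- _); apply: eq_bigr => j jn.
  by rewrite jn.
have vE i : v i = w i * 2 ^ kappa i.
  have [h|h] := ltnP i.+1 n; first by rewrite /w /kappa h; have [] := wkP i.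
  have {}h : i.+1 = n by apply/eqP; rewrite eqn_leq ltn_ord.
  have /last_entryP vn := prodv; rewrite vn => [|j|//]; last by rewrite gt_eqF.
  have /last_entryP kn' := prod_pow2_eq1 kn.
  rewrite wn// kn' => [|j|//]; last by rewrite expfz_neq0.
  rewrite -big_split/=; apply: eq_bigr => j jn.
  by rewrite -invfM /w /kappa jn; have [_ ->] := wkP j.
have [y [mu [y01 yE]]] := unip_decomposition
  (fun i j => v i * u i j / (w i * 2 ^ kappa j)).
exists (s *: (k *m z_mx w y)), (2 ^ l *: q_mx R kappa mu); split.
- by exists s, k, w, y.
- by exists l, kappa, mu.
rewrite -scalemxAl -scalemxAr scalerA -rE; congr (_ *: _).
rewrite -mulmxA; congr (_ *m _); apply/matrixP => i j.
rewrite mul_z_q_mx mxE; case: ifP => // _; case: ifP => // ij.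
by rewrite yE// [RHS]mulrC divfK// mulf_neq0 ?expfz_neq0// gt_eqF// (w_gt0 w12 wn).
Qed.

(** The Gram matrix determines the triangular factor
    [s 2^l z(w, y) q(kappa, mu)], whose determinant gives [s 2^l], then whose
    diagonal gives [w i 2^(kappa i)], then whose other entries give the unipotent
    product; each of the three determines its integral part. *)
Lemma tiling_uniq (f f' p p' : 'M[R]_n) :
  F_mx f -> F_mx f' -> P_mx p -> P_mx p' -> f *m p = f' *m p' -> p = p'.
Proof.
move=> [s [k [w [y [[s12 ok w12 wn y01] ->]]]]].
move=> [s' [k' [w' [y' [[s'12 ok' w'12 w'n y'01] ->]]]]].
move=> [l [kappa [mu [kn ->]]]] [l' [kappa' [mu' [k'n ->]]]].
rewrite -!scalemxAl -!scalemxAr !scalerA -!mulmxA => e.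
have p0 (m : int) : 0 < (2 : R) ^ m by rewrite exprz_gt0.
have s_gt0 (x : R) : x \in `[1, 2[ -> 0 < x.
  by rewrite in_itv/= => /andP[/(lt_le_trans ltr01)].
have s0 := s_gt0 _ s12; have s'0 := s_gt0 _ s'12.
have w0 := w_gt0 w12 wn; have w'0 := w_gt0 w'12 w'n.
have prodw : \prod_i w i = 1 by apply/last_entryP => // i; rewrite gt_eqF.
have prodw' : \prod_i w' i = 1 by apply/last_entryP => // i; rewrite gt_eqF.
have diagE (t : R) v x kap m i :
    (t *: (z_mx v x *m q_mx R kap m)) i i = t * (v i * 2 ^ kap i).
  by rewrite mxE mul_z_q_mx eqxx.
have upperE (t : R) v x kap m : upper (t *: (z_mx v x *m q_mx R kap m)).
  by move=> i j ji; rewrite mxE mul_z_q_mx -val_eqE/= gtn_eqF// ltnNge ltnW// mulr0.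
have TT : (s * 2 ^ l) *: (z_mx w y *m q_mx R kappa mu) =
          (s' * 2 ^ l') *: (z_mx w' y' *m q_mx R kappa' mu').
  apply: upper_gram_inj => [||i|i|]; try exact: upperE.
  - by rewrite diagE !mulr_gt0.
  - by rewrite diagE !mulr_gt0.
  rewrite -[LHS](orthogonal_gram _ ok) -[RHS](orthogonal_gram _ ok').
  by rewrite -(scalemxAr _ k) -(scalemxAr _ k') e.
have diag i : (s * 2 ^ l) * (w i * 2 ^ kappa i) =
              (s' * 2 ^ l') * (w' i * 2 ^ kappa' i).
  by have /matrixP/(_ i i) := TT; rewrite !diagE.
have sl : s * 2 ^ l = s' * 2 ^ l'.
  have : \prod_i ((s * 2 ^ l) * (w i * 2 ^ kappa i)) =
      \prod_i ((s' * 2 ^ l') * (w' i * 2 ^ kappa' i)).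
    by apply: eq_bigr => i _; exact: diag.
  rewrite !big_split/= prodw prodw' (prod_pow2_eq1 kn) (prod_pow2_eq1 k'n).
  rewrite !mulr1 -!big_split/=.
  rewrite !prodr_const card_ord => /eqP.
  by rewrite eqrXn2// ?mulr_ge0 ?ltW// => /eqP.
have [ss' ll'] := dyadic_uniq s12 s'12 sl.
have sl0 : s * 2 ^ l != 0 by rewrite mulf_neq0 ?gt_eqF.
have {}diag i : w i * 2 ^ kappa i = w' i * 2 ^ kappa' i.
  by have := diag i; rewrite -sl => /(mulfI sl0).
have wk (i : 'I_n) : (i.+1 < n)%N -> w i = w' i /\ kappa i = kappa' i.
  by move=> h; apply: dyadic_uniq => //; [exact: w12|exact: w'12].
have kk i : kappa i = kappa' i.
  have [/wk[]//|h] := ltnP i.+1 n.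
  have {}h : i.+1 = n by apply/eqP; rewrite eqn_leq ltn_ord.
  by rewrite kn// k'n//; congr (- _); apply: eq_bigr => j /wk[].
have ww i : w i = w' i.
  by have := diag i; rewrite kk => /mulIf; apply; rewrite gt_eqF.
rewrite -ll'; congr (_ *: _); apply/matrixP => i j; rewrite !mxE kk.
case: ifP => // ij; case: ifP => // ltij; rewrite kk; congr (_ * _%:~R).
apply: (proj2 (unip_uniq y01 y'01 _ ltij)) => a b ab.
have /matrixP/(_ a b) := TT; rewrite -sl [LHS]mxE [RHS]mxE => /(mulfI sl0).
rewrite !mul_z_q_mx -val_eqE/= ltn_eqF// ab ww kk => /mulfI; apply.
by rewrite mulf_neq0 ?gt_eqF.
Qed.

End coordinates.

(** * Polynomial inequalities for the fundamental set *)

Section walls.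
Variables (R : realType) (n : nat).
Hypothesis n_gt0 : (0 < n)%N.
Local Notation index := (option ('I_n * 'I_n)).
Implicit Types (a : index) (A k : 'M[R]_n) (s : R) (w : 'I_n -> R)
  (y : 'I_n -> 'I_n -> R).

(** An index is [None] for [s], [Some (i, i)] for [w i] and [Some (i, j)] for
    [y i j]; this predicate selects the free coordinates, which leave out the
    last [w i]. *)
Definition coord_index a : bool :=
  match a with
  | None => true
  | Some (i, j) => if i == j then (i.+1 < n)%N else (i < j)%N
  end.

Definition iwasawa_coord s w y a : R :=
  match a with
  | None => s
  | Some (i, j) => if i == j then w i else y i j
  end.

Definition off_diag a : bool := if a is Some (i, j) then i != j else false.

Definition coord_lo a : R := if off_diag a then 0 else 1.
Definition coord_hi a : R := if off_diag a then 1 else 2.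

(** The determinant and the minors of the Gram matrix yield [s ^ (2 n)] and
    [s ^ 2 * w i ^ 2]: it takes the power [2 n] of [s] and of [w i] to get
    quotients of polynomials. *)
Definition coord_exp a : nat := if off_diag a then 1 else (2 * n)%N.

Definition coord_num a A : R :=
  match a with
  | None => (\det A) ^+ 2
  | Some (i, j) =>
    bordered_minor i j (A^T *m A) ^+ (if i == j then n else 1)
  end.

Definition coord_den a A : R :=
  match a with
  | None => 1
  | Some (i, j) =>
    if i == j then (\det A) ^+ 2 * prev_minor i (A^T *m A) ^+ n
    else bordered_minor i i (A^T *m A)
  end.

(** The value 1 at the indices that are not free coordinates makes the
    corresponding inequality hold everywhere. *)
Definition wall (ab : index * bool) A : R :=
  let: (a, hi) := ab in
  if ~~ coord_index a then 1
  else if hi then coord_hi a ^+ coord_exp a * coord_den a A - coord_num a A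
  else coord_num a A - coord_lo a ^+ coord_exp a * coord_den a A.

Lemma polyfun_wall ab : polyfun (wall ab).
Proof.
have pgram i j : polyfun (fun A => (A^T *m A) i j).
  apply: (@polyfun_ext _ _ (fun A => \sum_k A k i * A k j)).
    by move=> A; rewrite mxE; apply: eq_bigr => k _; rewrite mxE.
  by apply: polyfun_sum => k; apply: polyfun_mul; exact: polyfun_coord.
have pminor m (mn : (m <= n)%N) c : polyfun (fun A => lead_minor mn c (A^T *m A)).
  exact: polyfun_lead_minor.
have pdet : polyfun (fun A => (\det A) ^+ 2).
  by apply: polyfun_exp; exact: polyfun_determinant.
have pnum a : polyfun (coord_num a).
  by case: a => [[i j]|] //; apply: polyfun_exp; exact: pminor.
have pden a : polyfun (coord_den a).
  case: a => [[i j]|]; last exact: polyfun_cst.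
  rewrite /coord_den; case: (i == j); last exact: pminor.
  by apply: polyfun_mul => //; apply: polyfun_exp; exact: pminor.
case: ab => a b; rewrite /wall.
case: (coord_index a) => /=; last exact: polyfun_cst.
by case: b; apply: polyfun_sub => //; apply: polyfun_mul => //; exact: polyfun_cst.
Qed.

Section values.
Variables (s : R) (k : 'M[R]_n) (w : 'I_n -> R) (y : 'I_n -> 'I_n -> R).
Hypotheses (s_gt0 : 0 < s) (ok : orthogonal_mx k) (w_gt0 : forall i, 0 < w i).
Hypothesis prodw : \prod_i w i = 1.
Let A := s *: (k *m z_mx w y).
Let T := s *: z_mx w y.

Let upT : upper T.
Proof.
by move=> i j ji; rewrite !mxE -val_eqE/= gtn_eqF// ltnNge ltnW// mulr0.
Qed.

Let gramA : A^T *m A = T^T *m T.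
Proof.
by rewrite /A scalemxAr orthogonal_gram.
Qed.

Let Tii i : T i i = s * w i.
Proof. by rewrite !mxE eqxx. Qed.

Let Tij (i j : 'I_n) : (i < j)%N -> T i j = s * w i * y i j.
Proof. by move=> ij; rewrite !mxE -val_eqE/= ltn_eqF// ij mulrA. Qed.

Let T_gt0 i : 0 < T i i.
Proof. by rewrite Tii mulr_gt0. Qed.

Let detA2 : (\det A) ^+ 2 = s ^+ (2 * n).
Proof.
rewrite expr2 -{1}det_tr -det_mulmx gramA det_mulmx det_tr -expr2 det_upper//.
rewrite (eq_bigr (fun i => s * w i)) => [|i _]; last exact: Tii.
by rewrite big_split/= prodr_const card_ord prodw mulr1 mulnC exprM.
Qed.

Lemma coord_den_gt0 a : 0 < coord_den a A.
Proof.
case: a => [[i j]|] //=; rewrite gramA; case: ifP => _.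
  by rewrite detA2 mulr_gt0// exprn_gt0// prev_minor_gt0.
by rewrite bordered_minor_gram// !mulr_gt0// prev_minor_gt0.
Qed.

(** For the triangular factor [T] of [A], the bordered minors at [(i, i)] and
    [(i, j)] are the previous minor times [T i i ^ 2 = s ^ 2 * w i ^ 2] and times
    [T i i * T i j = s ^ 2 * w i ^ 2 * y i j]. *)
Lemma coord_numE a : coord_index a ->
  coord_num a A = iwasawa_coord s w y a ^+ coord_exp a * coord_den a A.
Proof.
rewrite /coord_exp; case: a => [[i j]|] /=; last by rewrite detA2 mulr1.
rewrite gramA; have [<- _|ij ltij] /= := eqVneq i j.
  by rewrite bordered_minor_gram// Tii detA2 !exprM -!exprMn; congr (_ ^+ n); ring.
rewrite !expr1 (bordered_minor_gram i j upT) (bordered_minor_gram i i upT).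
by rewrite Tii Tij//; ring.
Qed.

Let coord_pow_le a (x x' : R) : off_diag a || ((0 <= x) && (0 <= x')) ->
  (x ^+ coord_exp a <= x' ^+ coord_exp a) = (x <= x').
Proof.
rewrite /coord_exp; case: (off_diag a) => /=; first by rewrite !expr1.
by move=> /andP[x0 x'0]; rewrite ler_pXn2r// muln_gt0.
Qed.

Let coord_lt a (x x' : R) : off_diag a || ((0 <= x) && (0 <= x')) ->
  (x ^+ coord_exp a < x' ^+ coord_exp a) = (x < x').
Proof. by move=> h; rewrite !ltNge coord_pow_le// [_ && _]andbC. Qed.

Let coord_ge0 a : off_diag a || (0 <= iwasawa_coord s w y a).
Proof.
by case: a => [[i j]|] /=; [case: eqVneq => //= _; rewrite ltW|rewrite ltW].
Qed.

Lemma wall_lo_gt0 a : coord_index a ->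
  (0 < wall (a, false) A) = (coord_lo a < iwasawa_coord s w y a).
Proof.
move=> ia; rewrite /wall ia/= subr_gt0 coord_numE// ltr_pM2r ?coord_den_gt0//.
apply: coord_lt; have := coord_ge0 a; rewrite /coord_lo.
by case: (off_diag a) => //= ->; rewrite ler01.
Qed.

Lemma wall_lo_ge0 a : coord_index a ->
  (0 <= wall (a, false) A) = (coord_lo a <= iwasawa_coord s w y a).
Proof.
move=> ia; rewrite /wall ia/= subr_ge0 coord_numE// ler_pM2r ?coord_den_gt0//.
apply: coord_pow_le; have := coord_ge0 a; rewrite /coord_lo.
by case: (off_diag a) => //= ->; rewrite ler01.
Qed.

Lemma wall_hi_gt0 a : coord_index a ->
  (0 < wall (a, true) A) = (iwasawa_coord s w y a < coord_hi a).
Proof.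
move=> ia; rewrite /wall ia/= subr_gt0 coord_numE// ltr_pM2r ?coord_den_gt0//.
apply: coord_lt; have := coord_ge0 a; rewrite /coord_hi.
by case: (off_diag a) => //= ->; rewrite ler0n.
Qed.

End values.

Lemma coord_itvP s w y :
  (forall a, coord_index a -> iwasawa_coord s w y a \in `[coord_lo a, coord_hi a[)
  <->
  [/\ s \in `[1, 2[, forall i : 'I_n, (i.+1 < n)%N -> w i \in `[1, 2[ &
      forall i j : 'I_n, (i < j)%N -> y i j \in `[0, 1[].
Proof.
split=> [h|[s12 w12 y01] [[i j]|]//=].
  split=> [|i ni|i j ij]; first exact: (h None isT).
    by have := h (Some (i, i)); rewrite /coord_lo /coord_hi /= eqxx; exact.
  have ijN : (i == j) = false by rewrite -val_eqE ltn_eqF.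
  by have := h (Some (i, j)); rewrite /coord_lo /coord_hi /= ijN; exact.
by rewrite /coord_lo /coord_hi /=; case: eqVneq => /= _ ij; [exact: w12|exact: y01].
Qed.

Lemma F_mx_wall_ge0 A ab : F_mx A -> 0 <= wall ab A.
Proof.
move=> [s [k [w [y [[s12 ok w12 wn y01] ->]]]]].
have w0 := w_gt0 w12 wn.
have s0 : 0 < s.
  by move: s12; rewrite in_itv/= => /andP[/(lt_le_trans ltr01)].
have prodw : \prod_i w i = 1 by apply/last_entryP => // i; rewrite gt_eqF.
case: ab => a b; have [ia|nia] := boolP (coord_index a); last by rewrite /wall nia.
have /coord_itvP/(_ a ia) := And3 s12 w12 y01.
rewrite in_itv/= => /andP[lo hi]; case: b; last by rewrite wall_lo_ge0.
by rewrite ltW// wall_hi_gt0.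
Qed.

Lemma wall_gt0_F_mx A : A \in unitmx -> (forall ab, 0 < wall ab A) -> F_mx A.
Proof.
move=> /(iwasawa n_gt0)[s [k [w [y [s0 ok w0 prodw ->]]]]] A0.
have [s12 w12 y01] : [/\ s \in `[1, 2[,
    forall i : 'I_n, (i.+1 < n)%N -> w i \in `[1, 2[ &
    forall i j : 'I_n, (i < j)%N -> y i j \in `[0, 1[].
  apply/coord_itvP => a ia; rewrite in_itv/=.
  rewrite -(wall_hi_gt0 y s0 ok w0 prodw ia) A0 andbT ltW//.
  by rewrite -(wall_lo_gt0 y s0 ok w0 prodw ia) A0.
exists s, k, w, y; split => //; split => //.
by apply/last_entryP => // i; rewrite gt_eqF.
Qed.

(** One point in the interior shows that none of the polynomials vanishes
    identically. *)
Lemma wall_interior : exists2 A, A \in unitmx & forall ab, 0 < wall ab A.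
Proof.
pose w (i : 'I_n) : R := if (i.+1 < n)%N then 3 / 2
  else \prod_(j < n | (j.+1 < n)%N) (3 / 2)^-1.
have wE (i : 'I_n) : (i.+1 < n)%N -> w i = 3 / 2 by rewrite /w => ->.
have w12 (i : 'I_n) : (i.+1 < n)%N -> w i \in `[1, 2[.
  by move=> /wE ->; rewrite in_itv/=; apply/andP; split; lra.
have wn (i : 'I_n) : i.+1 = n -> w i = \prod_(j < n | (j.+1 < n)%N) (w j)^-1.
  by move=> h; rewrite /w h ltnn; apply: eq_bigr => j jn; rewrite jn.
have w0 := w_gt0 w12 wn.
have prodw : \prod_i w i = 1 by apply/last_entryP => // i; rewrite gt_eqF.
have s0 : 0 < 3 / 2 :> R by lra.
have o1 : orthogonal_mx (1%:M : 'M[R]_n) by rewrite /orthogonal_mx trmx1 mulmx1.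
pose y (i j : 'I_n) : R := 1 / 2.
exists ((3 / 2) *: (1%:M *m z_mx w y)).
  apply: F_mx_unit; exists (3 / 2), 1%:M, w, y; split => //; split => //.
    by rewrite in_itv/=; apply/andP; split; lra.
  by move=> i j _; rewrite in_itv/= /y; apply/andP; split; lra.
move=> [a b]; have [ia|nia] := boolP (coord_index a); last by rewrite /wall nia.
have : coord_lo a < iwasawa_coord (3 / 2) w y a < coord_hi a.
  rewrite /coord_lo /coord_hi; case: a ia => [[i j]|] /=; last by lra.
  by case: eqVneq => /= _ => [/wE ->|_]; rewrite /y; lra.
by case: b => /andP[lo hi]; rewrite ?wall_hi_gt0// wall_lo_gt0.
Qed.

End walls.

(** * The boundary of the fundamental set *)

Section boundary.
Variables (R : realType) (n : nat).
Hypothesis n_gt0 : (0 < n)%N.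
Local Notation G := (GL R n).
Local Notation mx := (@mx_of_GL R n).
Variable lambda : {measure set (borelType G) -> \bar R}.
Hypothesis haar : left_haar_measure lambda.

Lemma closure_F_wall (x : G) ab : closure (F R n) x -> 0 <= wall ab (mx x).
Proof.
have cl : closed [set z : G | 0 <= wall ab (mx z)].
  have /continuous_closedP cw := polyfun_GL_continuous (polyfun_wall R ab).
  by have := cw _ (@closed_ge R 0).
move=> clx; apply: cl; apply: closure_subset clx => z Fz.
exact: F_mx_wall_ge0.
Qed.

(** A point of the closure satisfies all the inequalities weakly, and a point
    that satisfies all of them strictly is in [F]. *)
Lemma boundary_F (x : G) : closure (F R n) x -> ~ F R n x ->
  exists ab, wall ab (mx x) = 0.
Proof.
move=> clx nFx; apply: contrapT => /forallNP nw; apply: nFx.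
apply: wall_gt0_F_mx => //; first exact: mx_of_GL_unit.
by move=> ab; rewrite lt_neqAle closure_F_wall// andbT eq_sym; apply/eqP.
Qed.

Lemma boundary_translate_negligible (p : G) :
  lambda.-negligible
    ([set x | (closure (F R n) `\` F R n) (x * p^-1)%g] : set (borelType G)).
Proof.
pose f ab (A : 'M[R]_n) := wall ab (A *m invmx (mx p)).
have pf ab : polyfun (f ab).
  by apply: polyfun_comp (polyfun_wall R ab) => i j; exact: polyfun_mulmxr.
have [A0 uA0 A0_gt0] := wall_interior R n_gt0.
have fg ab : f ab (mx (toGL uA0 * p)%g) != 0.
  rewrite /f /= mulmxK ?mx_of_GL_unit//.
  by rewrite gt_eqF.
apply: negligibleS (negligible_bigcup_count
  (fun ab => haar_zeros haar (pf ab) (fg ab))).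
by move=> x [clx nFx]; have [ab xab] := boundary_F clx nFx; exists ab.
Qed.

End boundary.

Theorem corollary4p3 (R : realType) (n : nat) (n_gt0 : (0 < n)%N)
    (lambda : {measure set (borelType (GL R n)) -> \bar R})
    (haar : left_haar_measure lambda) :
  (forall p q : GL R n, P R n p -> P R n q -> p <> q ->
     lambda (right_translate (closure (F R n)) p `&`
             right_translate (closure (F R n)) q) = 0%E) /\
  lambda (~` \bigcup_(p in P R n) right_translate (closure (F R n)) p) = 0%E.
Proof.
split=> [p q Pp Pq pq|].
  have closed_translate (r : GL R n) :
      closed (right_translate (closure (F R n)) r).
    rewrite right_translateE.
    exact: (proj1 (continuous_closedP _) (@right_mul_continuous _ _ r^-1%g) _
              (@closed_closure _ _)).
  apply/negligibleP.
    by apply: measurableI; apply: closed_GL_measurable.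
  apply: negligibleS (negligibleU (boundary_translate_negligible n_gt0 haar p)
                                  (boundary_translate_negligible n_gt0 haar q)).
  rewrite !right_translateE => x [/= clp clq].
  have [Fp|nFp] := pselect (F R n (x * p^-1)%g); last by left.
  have [Fq|nFq] := pselect (F R n (x * q^-1)%g); last by right.
  exfalso; apply: pq; apply: mx_of_GL_inj.
  apply: (tiling_uniq n_gt0 Fp Fq Pp Pq).
  transitivity (mx_of_GL x).
    by rewrite -[RHS](congr1 (@mx_of_GL R n) (mulgVK p x)).
  by rewrite -[LHS](congr1 (@mx_of_GL R n) (mulgVK q x)).
rewrite (_ : ~` _ = set0) ?measure0//.
apply/seteqP; split => // x; apply.
have [f [p [Ff Pp xE]]] := tiling_cover n_gt0 (mx_of_GL_unit x).
have uf := F_mx_unit Ff; have up := P_mx_unit Pp.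
exists (toGL up) => //; exists (toGL uf); first exact: subset_closure.
by apply: mx_of_GL_inj; rewrite xE.
Qed.
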